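(* Let $M$ be a pointed metric space, i.e. a metric space with a fixed base point $0\in M$. The following statements are equivalent: (i) the dual Banach space $\mathrm{Lip}_0(M)=\mathcal{F}(M)^*$ has the weak$^*$ symmetric strong diameter $2$ property; (ii) $M$ has the strong long trapezoid property.
   Context: All Banach spaces are real. For a Banach space $X$, $B_X$, $S_X$, $X^*$ denote its closed unit ball, unit sphere and dual. A weak$^*$ slice of $B_{X^*}$ is a set of the form $S(B_{X^*},x,\alpha)=\{x^*\in B_{X^*}: \langle x,x^*\rangle>1-\alpha\}$ with $x\in S_X$ and $\alpha>0$. The dual space $X^*$ has the weak$^*$ symmetric strong diameter $2$ property if, for every finite family $(S_i)_{i=1}^n$ of weak$^*$ slices of $B_{X^*}$ (the empty family, $n=0$, being allowed) and every $\varepsilon>0$, there exist $f_i\in S_i$, $i=1,\dots,n$, and $g\in B_{X^*}$ such that $f_i+g\in S_i$ and $f_i-g\in S_i$ for every $i\in\{1,\dots,n\}$, and $\|g\|>1-\varepsilon$. For a metric space $M$ with metric $d$ and base point $0$, $\mathrm{Lip}_0(M)$ is the Banach space of all Lipschitz functions $f\colon M\to\mathbb{R}$ with $f(0)=0$, with norm $\|f\|=\sup\{|f(x)-f(y)|/d(x,y): x,y\in M,\ x\ne y\}$. For $m\in M$ let $\delta_m\in \mathrm{Lip}_0(M)^*$ be given by $\langle f,\delta_m\rangle=f(m)$. The Lipschitz-free space is $\mathcal{F}(M)=\overline{\mathrm{span}}\{\delta_m: m\in M\}\subset \mathrm{Lip}_0(M)^*$ (norm closure). Under this duality, $\mathcal{F}(M)^*$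 is isometrically isomorphic to $\mathrm{Lip}_0(M)$; weak$^*$ slices of $B_{\mathrm{Lip}_0(M)}$ are understood with respect to the predual $\mathcal{F}(M)$. A metric space $M$ has the strong long trapezoid property if, for every finite subset $N$ of $M$ and every $\varepsilon>0$, there exist $u,v\in M$, $u\neq v$, such that for all $x,y\in N$ $$(1-\varepsilon)\bigl(d(x,y)+d(u,v)\bigr)\le d(x,u)+d(y,v),$$ and for all $x,y,z,w\in N$ $$(1-\varepsilon)\bigl(2d(u,v)+d(x,y)+d(z,w)\bigr)\le d(x,u)+d(y,u)+d(z,v)+d(w,v).$$ *)

(* Defs.v *)
From HB Require Import structures.
From mathcomp Require Import all_boot all_order all_algebra.
From mathcomp Require Import all_classical reals topology normedtype.

Set Implicit Arguments.
Unset Strict Implicit.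
Unset Printing Implicit Defensive.

Import Order.TTheory GRing.Theory Num.Theory.
Import numFieldNormedType.Exports.

Local Open Scope classical_set_scope.
Local Open Scope ring_scope.

Section Dual.
Variables (R : realType) (X : normedModType R).

Definition dual_pred : {pred X -> R} :=
  mem [set f : X -> R | linear f /\ continuous f].

Record dual := Dual { dual_fun :> X -> R; _ : dual_fun \in dual_pred }.

HB.instance Definition _ := [isSub for dual_fun].
HB.instance Definition _ := [Choice of dual by <:].

Lemma dual_submod_closed : submod_closed dual_pred.
Proof.
split.
  rewrite inE; split=> [a u v|]; last exact: cst_continuous.
  by rewrite /= scaler0 addr0.
move=> a f g; rewrite !inE => -[fl fc] [gl gc]; split.
  move=> b u v; rewrite !fctE fl gl scalerDr scalerDr !scalerA (mulrC a b).
  by rewrite addrACA.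
by move=> x; apply: cvgD; [apply: cvgZl_tmp; exact: fc|exact: gc].
Qed.

HB.instance Definition _ :=
  GRing.isSubmodClosed.Build _ _ dual_pred dual_submod_closed.
HB.instance Definition _ := [SubChoice_isSubLmodule of dual by <:].

Lemma dualP (f : dual) : linear f /\ continuous f.
Proof. by have := valP f; rewrite inE. Qed.

Lemma dual_linear (f : dual) : linear f. Proof. exact: (dualP f).1. Qed.

HB.instance Definition _ (f : dual) :=
  GRing.isLinear.Build R X R *:%R f (dual_linear f).

Lemma dual_continuous (f : dual) : continuous f.
Proof. exact: (dualP f).2. Qed.

Lemma bounded_dual_pred (f : X -> R) (k : R) :
  linear f -> (forall x, `|f x| <= k * `|x|) -> f \in dual_pred.
Proof.
move=> fl fk; rewrite inE; split => //.
pose F : {linear X -> R} := HB.pack f (GRing.isLinear.Build R X R *:%R f fl).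
apply: (@bounded_linear_continuous _ _ _ F); apply/linear_boundedP.
near=> r => x; apply: le_trans (fk x) _; rewrite ler_wpM2r//.
by near: r; apply: nbhs_pinfty_ge; rewrite num_real.
Unshelve. all: by end_near. Qed.

Definition dual_norm (f : dual) : R :=
  sup [set `|f x| | x in [set x : X | `|x| <= 1]].

Lemma dual_norm_has_ubound (f : dual) :
  has_ubound [set `|f x| | x in [set x : X | `|x| <= 1]].
Proof.
have /linear_bounded_continuous/linear_boundedP/pinfty_ex_gt0[k k0 fk] :=
  @dual_continuous f.
exists k => _ [x x1 <-]; apply: le_trans (fk x) _.
by rewrite ler_piMr// ltW.
Qed.

Lemma dual_norm_ge0 (f : dual) : 0 <= dual_norm f.
Proof.
apply: ub_le_sup; first exact: dual_norm_has_ubound.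
by exists 0; rewrite /= ?linear0 normr0.
Qed.

Lemma dual_normP (f : dual) (x : X) : `|f x| <= dual_norm f * `|x|.
Proof.
have [->|x0] := eqVneq x 0; first by rewrite linear0 !normr0 mulr0.
have nx0 : 0 < `|x| by rewrite normr_gt0.
rewrite -ler_pdivrMr//; apply: ub_le_sup; first exact: dual_norm_has_ubound.
exists (`|x|^-1 *: x) => /=.
  by rewrite normrZ normfV normr_id mulVf// gt_eqF.
by rewrite linearZ /= normrZ normfV normr_id mulrC.
Qed.

Lemma dual_norm_le (f : dual) (k : R) :
  0 <= k -> (forall x, `|f x| <= k * `|x|) -> dual_norm f <= k.
Proof.
move=> k0 fk; apply: ge_sup; first by exists `|f 0|, 0 => //=; rewrite normr0.
by move=> _ [x x1 <-]; apply: le_trans (fk x) _; rewrite ler_piMr.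
Qed.

Lemma ler_dual_normD (f g : dual) :
  dual_norm (f + g) <= dual_norm f + dual_norm g.
Proof.
apply: dual_norm_le => [|x]; first by rewrite addr_ge0 ?dual_norm_ge0.
by rewrite mulrDl (le_trans (ler_normD _ _))// lerD ?dual_normP.
Qed.

Lemma dual_normZ (a : R) (f : dual) : dual_norm (a *: f) = `|a| * dual_norm f.
Proof.
have le b (g : dual) : dual_norm (b *: g) <= `|b| * dual_norm g.
  apply: dual_norm_le => [|x]; first by rewrite mulr_ge0 ?dual_norm_ge0.
  rewrite -mulrA [leLHS](_ : _ = `|b| * `|g x|); last exact: normrM.
  by rewrite ler_wpM2l// dual_normP.
apply/eqP; rewrite eq_le le/=.
have [->|a0] := eqVneq a 0; first by rewrite normr0 mul0r dual_norm_ge0.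
rewrite -ler_pdivlMl ?normr_gt0// -normfV.
by rewrite -{1}[f]scale1r -(mulVf a0) -scalerA le.
Qed.

Lemma dual_norm0_eq0 (f : dual) : dual_norm f = 0 -> f = 0.
Proof.
move=> f0; apply/val_inj/funext => x; apply/eqP.
by rewrite -normr_le0 (le_trans (dual_normP f x))// f0 mul0r.
Qed.

HB.instance Definition _ :=
  Lmodule_isNormed.Build R dual ler_dual_normD dual_normZ dual_norm0_eq0.

End Dual.

Arguments dual_pred {R} X.

(* [dual_space X Y] presents [Y] as the dual Banach space [X^*] through a
   linear isometry of [Y] onto [dual X]; [X] is the predual that the weak-star
   slices of the unit ball of [Y] refer to. *)
Record dual_space (R : realType) (X Y : normedModType R) := DualSpace {
  pairing :> {linear Y -> dual X};
  pairing_isometry : forall y, `|pairing y| = `|y|;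
  pairing_surj : forall phi, exists y, pairing y = phi }.

Section SSD2P.
Variables (R : realType) (X Y : normedModType R) (J : dual_space X Y).

Definition wstar_slice (x : X) (alpha : R) : set Y :=
  [set y | `|y| <= 1 /\ 1 - alpha < J y x].

Definition is_wstar_slice (S : set Y) : Prop :=
  exists (x : X) (alpha : R),
    [/\ `|x| = 1, 0 < alpha & S = wstar_slice x alpha].

Definition wstar_SSD2P : Prop :=
  forall (n : nat) (S : 'I_n -> set Y) (eps : R),
    (forall i, is_wstar_slice (S i)) -> 0 < eps ->
    exists (f : 'I_n -> Y) (g : Y),
      [/\ forall i, S i (f i), `|g| <= 1,
          forall i, S i (f i + g) /\ S i (f i - g)
        & 1 - eps < `|g|].

End SSD2P.

Section Lip0.
Variables (R : realType) (M : metricType R) (p0 : M).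

Definition lip0_pred : {pred M -> R} :=
  mem [set f : M -> R | f p0 = 0 /\
    exists k : R, forall x y, `|f x - f y| <= k * mdist x y].

Record lip0 := Lip0 { lip0_fun :> M -> R; _ : lip0_fun \in lip0_pred }.

HB.instance Definition _ := [isSub for lip0_fun].
HB.instance Definition _ := [Choice of lip0 by <:].

Lemma lip0_submod_closed : submod_closed lip0_pred.
Proof.
split.
  by rewrite inE; split=> //; exists 0 => x y; rewrite /= subrr normr0 mul0r.
move=> a f g; rewrite !inE => -[f0 [k fk]] [g0 [l gl]]; split.
  by rewrite !fctE f0 g0 scaler0 addr0.
exists (`|a| * k + l) => x y; rewrite !fctE opprD addrACA -scalerBr mulrDl.
rewrite (le_trans (ler_normD _ _))// lerD// normrZ -mulrA.
by rewrite ler_wpM2l.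
Qed.

HB.instance Definition _ :=
  GRing.isSubmodClosed.Build _ _ lip0_pred lip0_submod_closed.
HB.instance Definition _ := [SubChoice_isSubLmodule of lip0 by <:].

Definition slopes (f : M -> R) : set R :=
  [set r | exists x y : M, x != y /\ r = `|f x - f y| / mdist x y].

(* Since [sup set0 = 0], the zero function on a singleton has norm 0. *)
Definition lip0_norm (f : lip0) : R := sup (slopes f).

Lemma lip0_base (f : lip0) : f p0 = 0.
Proof. by have := valP f; rewrite inE => -[]. Qed.

Lemma slopes_has_ubound (f : lip0) : has_ubound (slopes f).
Proof.
have := valP f; rewrite inE => -[_ [k fk]]; exists k => _ [x [y [xy ->]]].
by rewrite ler_pdivrMr ?mdist_gt0.
Qed.

Lemma lip0_norm_le (f : lip0) (k : R) : 0 <= k ->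
  (forall x y, `|f x - f y| <= k * mdist x y) -> lip0_norm f <= k.
Proof.
move=> k0 fk; rewrite /lip0_norm.
have [->|/set0P fr] := eqVneq (slopes f) set0; first by rewrite sup0.
apply: ge_sup => // _ [x [y [xy ->]]].
by rewrite ler_pdivrMr ?mdist_gt0.
Qed.

Lemma lip0_norm_ge0 (f : lip0) : 0 <= lip0_norm f.
Proof.
rewrite /lip0_norm.
have [->|/set0P[r fr]] := eqVneq (slopes f) set0; first by rewrite sup0.
apply: le_trans (ub_le_sup (slopes_has_ubound f) fr).
by case: fr => x [y [_ ->]]; rewrite divr_ge0 ?mdist_ge0.
Qed.

Lemma lip0_normP (f : lip0) (x y : M) :
  `|f x - f y| <= lip0_norm f * mdist x y.
Proof.
have [->|xy] := eqVneq x y; first by rewrite subrr normr0 mdistxx mulr0.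
rewrite -ler_pdivrMr ?mdist_gt0//; apply: ub_le_sup; last by exists x, y.
exact: slopes_has_ubound.
Qed.

Lemma ler_lip0_normD (f g : lip0) :
  lip0_norm (f + g) <= lip0_norm f + lip0_norm g.
Proof.
apply: lip0_norm_le => [|x y]; first by rewrite addr_ge0 ?lip0_norm_ge0.
rewrite [X in `|X|](_ : _ = (f x - f y) + (g x - g y)); last first.
  by rewrite addrACA -opprD.
by rewrite mulrDl (le_trans (ler_normD _ _))// lerD ?lip0_normP.
Qed.

Lemma lip0_normZ (a : R) (f : lip0) : lip0_norm (a *: f) = `|a| * lip0_norm f.
Proof.
have le b (g : lip0) : lip0_norm (b *: g) <= `|b| * lip0_norm g.
  apply: lip0_norm_le => [|x y]; first by rewrite mulr_ge0 ?lip0_norm_ge0.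
  rewrite [X in `|X|](_ : _ = b * (g x - g y)); last by rewrite mulrBr.
  by rewrite normrM -mulrA ler_wpM2l// lip0_normP.
apply/eqP; rewrite eq_le le/=.
have [->|a0] := eqVneq a 0; first by rewrite normr0 mul0r lip0_norm_ge0.
rewrite -ler_pdivlMl ?normr_gt0// -normfV.
by rewrite -{1}[f]scale1r -(mulVf a0) -scalerA le.
Qed.

Lemma lip0_norm0_eq0 (f : lip0) : lip0_norm f = 0 -> f = 0.
Proof.
move=> f0; apply/val_inj/funext => x; apply/eqP.
have := lip0_normP f x p0; rewrite f0 mul0r lip0_base subr0.
by rewrite normr_le0.
Qed.

HB.instance Definition _ :=
  Lmodule_isNormed.Build R lip0 ler_lip0_normD lip0_normZ lip0_norm0_eq0.

Lemma lip0_norm_pt (f : lip0) (m : M) : `|f m| <= mdist m p0 * `|f|.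
Proof. by have := lip0_normP f m p0; rewrite lip0_base subr0 mulrC. Qed.

End Lip0.

Arguments lip0_pred {R M} p0.
Arguments lip0 {R M} p0.

Section Free.
Variables (R : realType) (M : metricType R) (p0 : M).
Local Notation Lip0M := (lip0 p0).

Lemma delta_subproof (m : M) : (fun f : Lip0M => f m) \in dual_pred Lip0M.
Proof.
apply: (@bounded_dual_pred _ _ _ (mdist m p0)) => // f.
exact: lip0_norm_pt.
Qed.

Definition delta (m : M) : dual Lip0M := Dual (delta_subproof m).

Definition delta_span : set (dual Lip0M) :=
  [set mu | exists (n : nat) (c : 'I_n -> R) (m : 'I_n -> M),
    mu = \sum_(i < n) c i *: delta (m i)].

Definition free_pred : {pred dual Lip0M} := mem (closure delta_span).

(* The closure is taken for the norm topology of the dual of [lip0 p0]. *)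
Record free := Free { free_val :> dual Lip0M; _ : free_val \in free_pred }.

HB.instance Definition _ := [isSub for free_val].
HB.instance Definition _ := [Choice of free by <:].

Lemma delta_span_linear (a : R) (mu nu : dual Lip0M) :
  delta_span mu -> delta_span nu -> delta_span (a *: mu + nu).
Proof.
move=> [n [c [m ->]]] [n' [c' [m' ->]]]; exists (n + n')%N.
exists (fun i => match fintype.split i with inl j => a * c j | inr j => c' j end).
exists (fun i => match fintype.split i with inl j => m j | inr j => m' j end).
rewrite big_split_ord/= scaler_sumr; congr (_ + _); apply: eq_bigr => i _.
  by rewrite (fintype.unsplitK (inl _ i)) scalerA.
by rewrite (fintype.unsplitK (inr _ i)).
Qed.

Lemma free_predP (mu : dual Lip0M) : mu \in free_pred <->
  forall e, 0 < e -> exists2 nu, delta_span nu & `|mu - nu| < e.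
Proof.
rewrite inE; split=> [cmu e e0|H B]; last first.
  rewrite -nbhs_nbhs_norm => -[e /= e0 eB].
  by have [nu snu /eB Bnu] := H e e0; exists nu.
have [|nu [snu /= enu]] := cmu (ball_ Num.norm mu e); last by exists nu.
by rewrite -nbhs_nbhs_norm; exists e.
Qed.

Lemma free_submod_closed : submod_closed free_pred.
Proof.
split.
  apply/free_predP => e e0; exists 0; last by rewrite subrr normr0.
  by exists 0, (fun=> 0), (fun=> p0); rewrite big_ord0.
move=> a mu nu /free_predP Hmu /free_predP Hnu; apply/free_predP => e e0.
have a0 : 0 < `|a| + 1 by rewrite ltr_wpDl.
have e20 : 0 < e / 2 by rewrite divr_gt0.
have [mu' smu muE] := Hmu _ (divr_gt0 e20 a0).
have [nu' snu nuE] := Hnu _ e20.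
exists (a *: mu' + nu'); first exact: delta_span_linear.
rewrite opprD addrACA -scalerBr [e]splitr.
rewrite (le_lt_trans (ler_normD _ _))// ler_ltD// normrZ.
apply: (@le_trans _ _ ((`|a| + 1) * `|mu - mu'|)).
  by rewrite ler_wpM2r// lerDl.
by rewrite mulrC -ler_pdivlMr// ltW.
Qed.

HB.instance Definition _ :=
  GRing.isSubmodClosed.Build _ _ free_pred free_submod_closed.
HB.instance Definition _ := [SubChoice_isSubLmodule of free by <:].

Definition free_norm (mu : free) : R := `|free_val mu|.

Lemma ler_free_normD (mu nu : free) :
  free_norm (mu + nu) <= free_norm mu + free_norm nu.
Proof. exact: ler_normD. Qed.

Lemma free_normZ (a : R) (mu : free) :
  free_norm (a *: mu) = `|a| * free_norm mu.
Proof. exact: normrZ. Qed.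

Lemma free_norm0_eq0 (mu : free) : free_norm mu = 0 -> mu = 0.
Proof. by move=> /normr0_eq0 mu0; apply/val_inj. Qed.

HB.instance Definition _ :=
  Lmodule_isNormed.Build R free ler_free_normD free_normZ free_norm0_eq0.

Lemma delta_span_free (mu : dual Lip0M) : delta_span mu -> mu \in free_pred.
Proof. by rewrite inE => /subset_closure. Qed.

Lemma delta_spanE (m : M) : delta_span (delta m).
Proof.
by exists 1%N, (fun=> 1), (fun=> m); rewrite big_ord1 scale1r.
Qed.

Definition free_delta (m : M) : free :=
  Free (delta_span_free (delta_spanE m)).

Lemma free_eval_bound (f : Lip0M) (mu : free) : `|mu f| <= `|f| * `|mu|.
Proof. by rewrite mulrC; exact: dual_normP. Qed.

Lemma free_eval_subproof (f : Lip0M) :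
  (fun mu : free => mu f) \in dual_pred free.
Proof. exact: bounded_dual_pred (free_eval_bound f). Qed.

Definition free_eval (f : Lip0M) : dual free := Dual (free_eval_subproof f).

Lemma free_eval_linear : linear free_eval.
Proof.
by move=> a f g; apply/val_inj/funext => mu; exact: linearP.
Qed.

HB.instance Definition _ :=
  GRing.isLinear.Build R Lip0M (dual free) *:%R free_eval free_eval_linear.

Lemma free_delta_dist (x y : M) : `|free_delta x - free_delta y| <= mdist x y.
Proof.
apply: dual_norm_le => [|f]; first exact: mdist_ge0.
by rewrite mulrC; exact: lip0_normP.
Qed.

Lemma free_eval_isometry (f : Lip0M) : `|free_eval f| = `|f|.
Proof.
apply/eqP; rewrite eq_le; apply/andP; split.
  by apply: dual_norm_le => // mu; exact: free_eval_bound.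
apply: lip0_norm_le => // x y.
have := dual_normP (free_eval f) (free_delta x - free_delta y).
move=> /le_trans; apply; apply: ler_wpM2l; first exact: dual_norm_ge0.
exact: free_delta_dist.
Qed.

Lemma free_dual_ext (phi psi : dual free) :
  (forall m, phi (free_delta m) = psi (free_delta m)) -> phi = psi.
Proof.
move=> E; apply/eqP; rewrite -subr_eq0; apply/eqP.
set th := phi - psi.
have th0 m : th (free_delta m) = 0.
  by apply/eqP; rewrite subr_eq0; apply/eqP; exact: E.
apply/val_inj/funext => mu; apply/eqP; rewrite -normr_le0.
rewrite -[leLHS]/(`|th mu|); apply/ler_addgt0Pr => e e0; rewrite add0r.
have k0 : 0 < `|th| + 1 by rewrite ltr_wpDl.
have /free_predP/(_ _ (divr_gt0 e0 k0))[nu snu munu] := valP mu.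
have [n [c [m nuE]]] := snu.
pose nu' : free := \sum_(i < n) c i *: free_delta (m i).
have nu'E : free_val nu' = nu.
  by rewrite nuE -[LHS]/(\val nu') raddf_sum; apply: eq_bigr.
have thnu : th nu' = 0.
  rewrite linear_sum big1// => i _.
  by rewrite linearZ -[RHS](mulr0 (c i)) -(th0 (m i)).
have -> : th mu = th (mu - nu') by rewrite linearB [X in _ - X]thnu subr0.
apply: le_trans (dual_normP th _) _.
apply: (@le_trans _ _ ((`|th| + 1) * `|mu - nu'|)).
  by apply: ler_wpM2r => //; rewrite lerDl.
rewrite mulrC -ler_pdivlMr// ltW//.
by rewrite -nu'E in munu.
Qed.

Lemma free_eval_surj (phi : dual free) : exists f, free_eval f = phi.
Proof.
have phiP : (fun m => phi (free_delta m)) \in lip0_pred p0.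
  rewrite inE; split.
    rewrite (_ : free_delta p0 = 0) ?linear0//.
    by apply/val_inj/val_inj/funext => f; exact: lip0_base.
  exists `|phi| => x y; rewrite -linearB.
  apply: le_trans (dual_normP _ _) _.
  by apply: ler_wpM2l; [exact: dual_norm_ge0|exact: free_delta_dist].
by exists (Lip0 phiP); apply: free_dual_ext.
Qed.

Definition lip0_dual : dual_space free Lip0M :=
  DualSpace free_eval_isometry free_eval_surj.

End Free.

Arguments delta {R M} p0 m.
Arguments delta_span {R M} p0.
Arguments free_pred {R M} p0.
Arguments free {R M} p0.
Arguments free_delta {R M} p0 m.
Arguments lip0_dual {R M} p0.

Definition strong_LTP (R : realType) (M : metricType R) : Prop :=
  forall (N : set M) (eps : R), finite_set N -> 0 < eps ->
    exists u v : M, [/\ u != v,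
      forall x y, N x -> N y ->
        (1 - eps) * (mdist x y + mdist u v) <= mdist x u + mdist y v
    & forall x y z w, N x -> N y -> N z -> N w ->
        (1 - eps) * (2 * mdist u v + mdist x y + mdist z w)
          <= mdist x u + mdist y u + mdist z v + mdist w v].

(* Main.v *)
Require Import Defs.
From HB Require Import structures.
From mathcomp Require Import all_boot all_order all_algebra lra.
From mathcomp Require Import all_classical reals topology normedtype.

Set Implicit Arguments.
Unset Strict Implicit.
Unset Printing Implicit Defensive.

Import Order.TTheory GRing.Theory Num.Theory.
Import numFieldNormedType.Exports.

Local Open Scope ring_scope.

(** The norm of [g] and the membership of [f + g] and [f - g] in slices
of the unit ball are conditions on slopes, and everything rests on one
translation: [f + g] and [f - g] both lie in the unit ball exactly when
[|f z - f w| + |g z - g w| <= mdist z w] for all [z] and [w].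

From the diameter two property to trapezoids.  The slices of the molecules
[(delta x - delta y) / mdist x y], for distinct [x] and [y] in the finite set
[N], supply one function [g] of norm almost 1 and, for each such pair, an [f]
whose slope from [x] to [y] is almost 1.  On [N] the slopes of [g] are
therefore almost 0, whereas some pair [u], [v] has slope of [g] almost 1, so
that [f u] and [f v] almost coincide.  Adding the inequality above along
the segments joining points of [N] to [u] and [v] gives both trapezoid
inequalities, up to errors proportional to distances inside [N].  In the
second one these distances need not be comparable with [mdist u v]; but when
they are large, the inequality follows from the triangle inequality alone
([SSD2P_strong_LTP]).

From trapezoids to the diameter two property.  Elements of the free space are
approximated by combinations of point evaluations, so membership in a slice
[S i] is ensured by the values on a finite set, where they should agree with
those of [(1 - e) * h i] for some [h i] of the unit ball
([wstar_slice_local]).  Let [N] be the union of these finite sets and of the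
base point, and take [u], [v] from the trapezoid property.  The function [g]
is made of two cones, one of height [a] at [u], the other of height [- b] at
[v], with [a + b = (1 - e) * mdist u v] ([dipole]).  It vanishes on [N] and has
slope [1 - e] between [u] and [v].  Its partner [f i] has to be constant, equal
to some [c i], on the two balls where [g] lives, and near them may leave [c i]
only as fast as the distance to the balls grows: [f i] is [(1 - e) * h i]
truncated to that range ([clamp], [room]).  Then [f i + g] and [f i - g] are
1-Lipschitz ([clamp_dipole_nonexpansive]).  The truncation must leave the
values on [N] unchanged; a suitable [c i] exists because finitely many
intervals that meet pairwise have a common point ([clamp_center]), and they
meet pairwise precisely because of the first trapezoid inequality and of the
choice of [a] and [b], which the second one makes possible
([trapezoid_radii]). *)

(** * The unit ball of the Lipschitz space *)

Definition nonexpansive (R : realType) (M : metricType R) (f : M -> R) :=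
  forall z w, f z - f w <= mdist z w.

Lemma lip0_le1P (R : realType) (M : metricType R) (p0 : M) (f : lip0 p0) :
  `|f| <= 1 <-> nonexpansive f.
Proof.
split=> [f1 z w|fl].
  apply: le_trans (ler_norm _) _; apply: le_trans (lip0_normP f z w) _.
  by rewrite ler_piMl// mdist_ge0.
apply: lip0_norm_le => // z w; rewrite mul1r ler_norml fl andbT.
by have := fl w z; rewrite metric_sym; lra.
Qed.

Lemma nonexpansive_lip0 (R : realType) (M : metricType R) (p0 : M)
    (f : M -> R) : f p0 = 0 -> nonexpansive f ->
  exists2 F : lip0 p0, F =1 f & `|F| <= 1.
Proof.
move=> f0 fl.
have fP : f \in lip0_pred p0.
  rewrite inE; split=> //; exists 1 => z w; rewrite mul1r ler_norml fl andbT.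
  by have := fl w z; rewrite metric_sym; lra.
by exists (Lip0 fP) => //; apply/lip0_le1P.
Qed.

(** Choosing the sign of [g] that suits each pair of points turns the two bounds
into a single one, without loss. *)
Lemma nonexpansiveD (R : realType) (M : metricType R) (p0 : M)
    (f g : lip0 p0) :
  `|f + g| <= 1 -> `|f - g| <= 1 ->
  forall z w, (f z - f w) + `|g z - g w| <= mdist z w.
Proof.
move=> /lip0_le1P fg /lip0_le1P f'g z w; move: (fg z w) (f'g z w).
rewrite -[(f + g) z]/(f z + g z) -[(f + g) w]/(f w + g w).
rewrite -[(f - g) z]/(f z - g z) -[(f - g) w]/(f w - g w).
by case: (ger0P (g z - g w)) => _; lra.
Qed.

(** The distance function to [y], shifted to vanish at the base point, attains
the upper bound on the norm. *)
Lemma free_delta_distE (R : realType) (M : metricType R) (p0 x y : M) :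
  `|free_delta p0 x - free_delta p0 y| = mdist x y.
Proof.
apply/eqP; rewrite eq_le free_delta_dist/=.
have [||F FE F1] := @nonexpansive_lip0 R M p0 (fun z => mdist z y - mdist p0 y).
- by rewrite subrr.
- by move=> z w; have := metric_triangle z w y; lra.
have := free_eval_bound F (free_delta p0 x - free_delta p0 y).
rewrite -[X in `|X| <= _]/(F x - F y) !FE mdistxx => H.
apply: le_trans (le_trans H _); last by rewrite ler_piMl.
by apply: le_trans (ler_norm _); lra.
Qed.

(** * From symmetric slices to long trapezoids *)

Definition molecule (R : realType) (M : metricType R) (p0 x y : M) :
    Defs.free p0 :=
  (mdist x y)^-1 *: (free_delta p0 x - free_delta p0 y).

Lemma norm_molecule (R : realType) (M : metricType R) (p0 x y : M) :
  x != y -> `|molecule p0 x y| = 1.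
Proof.
move=> xy; rewrite normrZ free_delta_distE normfV ger0_norm ?mdist_ge0//.
by rewrite mulVf// gt_eqF// mdist_gt0.
Qed.

Lemma molecule_slice (R : realType) (M : metricType R) (p0 x y : M) (e : R)
    (f : lip0 p0) : x != y ->
  wstar_slice (lip0_dual p0) (molecule p0 x y) e f ->
  `|f| <= 1 /\ (1 - e) * mdist x y < f x - f y.
Proof.
move=> xy [f1 H]; split=> //; move: H.
rewrite -[X in _ < X -> _]/((mdist x y)^-1 * (f x - f y)).
by rewrite mulrC ltr_pdivlMr ?mdist_gt0.
Qed.

Lemma slope_witness (R : realType) (M : metricType R) (p0 : M)
    (g : lip0 p0) (c : R) : 0 <= c -> c < `|g| ->
  exists u v : M, u != v /\ c * mdist u v < g u - g v.
Proof.
move=> c0 cg.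
have sl0 : (slopes g !=set0)%classic.
  apply/set0P/eqP => sl0; move: cg.
  by rewrite -[`|g|]/(sup (slopes g)) sl0 sup0 ltNge c0.
have [_ [u [v [uv ->]]]] := sup_gt sl0 cg.
rewrite ltr_pdivlMr ?mdist_gt0// => H.
case: (ger0P (g u - g v)) H => _ H; first by exists u, v.
by exists v, u; rewrite eq_sym uv metric_sym; split=> //; lra.
Qed.

(** One slice for each pair of distinct points of [s]: both [f + g] and [f - g]
have slope more than [1 - e] from [x] to [y], hence the gain of
[`|g x - g y|].  For [x = y] the function [f = 0] does. *)
Lemma SSD2P_symmetric_family (R : realType) (M : metricType R) (p0 : M)
    (s : seq M) (e : R) :
  wstar_SSD2P (lip0_dual p0) -> 0 < e ->
  exists2 g : lip0 p0, 1 - e < `|g| &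
    forall x y, x \in s -> y \in s -> exists f : lip0 p0,
      [/\ `|f + g| <= 1, `|f - g| <= 1 &
          (1 - e) * mdist x y + `|g x - g y| <= f x - f y].
Proof.
move=> H e0.
pose ps := [seq p <- [seq (x, y) | x <- s, y <- s] | p.1 != p.2].
pose mol (i : 'I_(size ps)) :=
  let p := tnth (in_tuple ps) i in molecule p0 p.1 p.2.
have neq (i : 'I_(size ps)) :
    (tnth (in_tuple ps) i).1 != (tnth (in_tuple ps) i).2.
  by have := mem_tnth i (in_tuple ps); rewrite mem_filter => /andP[].
have [|f [g [_ g1 fg ge]]] :=
    H _ (fun i => wstar_slice (lip0_dual p0) (mol i) e) e _ e0.
  by move=> i; exists (mol i), e; split=> //; exact: norm_molecule (neq i).
exists g => // x y xs ys.
have [<-|xy] := eqVneq x y.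
  exists 0; rewrite add0r sub0r normrN; split=> //.
  by rewrite mdistxx !subrr normr0 mulr0 addr0.
have /tnthP[i iE] : (x, y) \in in_tuple ps.
  by rewrite mem_filter xy; apply/allpairsP; exists (x, y).
have xyi : mol i = molecule p0 x y by rewrite /mol -iE.
exists (f i); have [+ +] := fg i; rewrite xyi.
move=> /(molecule_slice xy)[? Hp] /(molecule_slice xy)[? Hm]; split=> //.
move: Hp Hm.
rewrite -[(f i + g) x]/(f i x + g x) -[(f i + g) y]/(f i y + g y).
rewrite -[(f i - g) x]/(f i x - g x) -[(f i - g) y]/(f i y - g y).
by case: (ger0P (g x - g y)) => _; lra.
Qed.

(** With [e = min(eps, 1) / 3], each inequality loses at most [3 * e] times the
quantity to be bounded below. *)
Lemma SSD2P_strong_LTP (R : realType) (M : metricType R) (p0 : M) :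
  wstar_SSD2P (lip0_dual p0) -> strong_LTP M.
Proof.
move=> H N eps /finite_seqP[s ->] eps0.
pose e := Num.min eps 1 / 3.
have [e0 e_eps e1] : [/\ 0 < e, 3 * e <= eps & 3 * e <= 1].
  by rewrite /e; case: (leP eps 1) => ?; split; lra.
have [g ge sym] := SSD2P_symmetric_family s H e0.
have [|u [v [uv guv]]] := slope_witness _ ge; first by lra.
have eM t : 0 <= t -> 0 <= e * t by move=> t0; rewrite mulr_ge0// ltW.
have absorb t : 0 <= t -> (1 - eps) * t <= (1 - 3 * e) * t.
  by move=> t0; rewrite ler_wpM2r//; lra.
have g_small x y : x \in s -> y \in s -> g x - g y <= e * mdist x y.
  move=> xs ys; have [f [fg f'g fxy]] := sym _ _ xs ys.
  have := nonexpansiveD fg f'g x y; have := normr_ge0 (g x - g y).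
  by have := ler_norm (g x - g y); lra.
exists u, v; split=> // [x y xs ys|x y z w xs ys zs ws].
  have [f [fg f'g fxy]] := sym _ _ xs ys.
  have := nonexpansiveD fg f'g x u; have := nonexpansiveD fg f'g v y.
  have := nonexpansiveD fg f'g u v.
  have := absorb _ (addr_ge0 (mdist_ge0 x y) (mdist_ge0 u v)).
  have := eM _ (mdist_ge0 x y); have := eM _ (mdist_ge0 u v).
  have := ler_norm (g u - g v); have := ler_norm (g y - g v).
  have := ler_norm (g u - g x); have := ler_norm (g x - g y).
  rewrite (distrC (g x) (g u)) (distrC (g v) (g y)) (metric_sym v y).
  move: (g_small _ _ xs ys) guv fxy (normr_ge0 (g x - g y)); lra.
have pair a b p : a \in s -> b \in s ->
    (1 - e) * mdist a b + `|g a - g p| + `|g b - g p|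
      <= mdist a p + mdist b p.
  move=> sa sb; have [f [fg f'g fab]] := sym _ _ sa sb.
  have := nonexpansiveD fg f'g a p; have := nonexpansiveD fg f'g p b.
  rewrite (distrC (g p)) (metric_sym p).
  by move: fab (normr_ge0 (g a - g b)); lra.
(* Replacing [g x], [g y] by [g z], [g w] costs [e] times the sum of the
distances [mdist x z] and [mdist y w].  If it is at most [2 * L], the
cost is absorbed; otherwise the triangle inequality through [u] and [v]
suffices. *)
set L := 2 * _ + _ + _.
have L0 : 0 <= L by rewrite !addr_ge0 ?mulr_ge0 ?mdist_ge0.
apply: le_trans (absorb L L0) _.
have [far|near_] := leP (2 * L) (mdist x z + mdist y w).
  have := eM L L0; have := mdist_ge0 x y; have := mdist_ge0 z w.
  have := metric_triangle x u z; have := metric_triangle u v z.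
  have := metric_triangle y u w; have := metric_triangle u v w.
  rewrite (metric_sym v z) (metric_sym v w).
  rewrite /L in far *; lra.
have : e * (mdist x z + mdist y w) <= e * (2 * L) by rewrite ler_pM2l// ltW.
have := pair x y u xs ys; have := pair z w v zs ws.
have := ler_norm (g u - g x); have := ler_norm (g u - g y).
have := ler_norm (g z - g v); have := ler_norm (g w - g v).
rewrite (distrC (g u) (g x)) (distrC (g u) (g y)).
have := g_small _ _ xs zs; have := g_small _ _ ys ws.
rewrite /L; move: guv; lra.
Qed.

(** * Two cones and the truncation that makes room for them *)

Lemma nonexpansive_max (R : realType) (M : metricType R) (f g : M -> R) :
  nonexpansive f -> nonexpansive g ->
  nonexpansive (fun z => Num.max (f z) (g z)).
Proof.
move=> fl gl z w; have := fl z w; have := gl z w.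
by case: (leP (f z) (g z)) => ?; case: (leP (f w) (g w)) => ?; lra.
Qed.

Lemma nonexpansive_min (R : realType) (M : metricType R) (f g : M -> R) :
  nonexpansive f -> nonexpansive g ->
  nonexpansive (fun z => Num.min (f z) (g z)).
Proof.
move=> fl gl z w; have := fl z w; have := gl z w.
by case: (leP (f z) (g z)) => ?; case: (leP (f w) (g w)) => ?; lra.
Qed.

Definition dipole (R : realType) (M : metricType R) (u v : M) (a b : R) (z : M) :=
  Num.max (a - mdist z u) 0 - Num.max (b - mdist z v) 0.

(** The distance from [z] to the union of the balls of radius [a] around [u]
and of radius [b] around [v], as far as the distances to [u] and [v] can
tell. *)
Definition room (R : realType) (M : metricType R) (u v : M) (a b : R) (z : M) :=
  Num.min (Num.max (mdist z u - a) 0) (Num.max (mdist z v - b) 0).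

Definition clamp (R : realType) (c r t : R) :=
  Num.max (c - r) (Num.min t (c + r)).

Lemma dipoleC (R : realType) (M : metricType R) (u v : M) (a b : R) (z : M) :
  dipole v u b a z = - dipole u v a b z.
Proof. by rewrite opprB. Qed.

Lemma roomC (R : realType) (M : metricType R) (u v : M) (a b : R) (z : M) :
  room v u b a z = room u v a b z.
Proof. exact: minC. Qed.

Lemma room_ge0 (R : realType) (M : metricType R) (u v : M) (a b : R) (z : M) :
  0 <= room u v a b z.
Proof. by rewrite /room le_min !le_max lexx !orbT. Qed.

Lemma room_nonexpansive (R : realType) (M : metricType R) (u v : M) (a b : R) :
  nonexpansive (room u v a b).
Proof.
have off c p : nonexpansive (fun z : M => Num.max (mdist z p - c) 0).
  apply: nonexpansive_max => z w; last by rewrite subrr mdist_ge0.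
  by have := metric_triangle z w p; lra.
exact: nonexpansive_min.
Qed.

Lemma clamp_dist (R : realType) (c r t : R) : 0 <= r -> `|clamp c r t - c| <= r.
Proof.
rewrite /clamp ler_norml => r0.
by case: (leP t (c + r)) => ?;
  [case: (leP (c - r) t)|case: (leP (c - r) (c + r))]; move=> ?; lra.
Qed.

Lemma clamp_id (R : realType) (c r t : R) : `|t - c| <= r -> clamp c r t = t.
Proof.
by rewrite ler_norml => /andP[? ?]; rewrite /clamp min_l ?max_r//; lra.
Qed.

Lemma clamp_nonexpansive (R : realType) (M : metricType R) (c : R)
    (r k : M -> R) : nonexpansive r -> nonexpansive k ->
  nonexpansive (fun z => clamp c (r z) (k z)).
Proof.
move=> rl kl; apply: nonexpansive_max => [z w|].
  by have := rl w z; rewrite (metric_sym w z); lra.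
by apply: nonexpansive_min => // z w; have := rl z w; lra.
Qed.

(** As [a + b <= mdist u v], the two balls do not overlap: at each point at most
one cone is nonzero, and the room is zero on both balls. *)
Lemma dipole_room (R : realType) (M : metricType R) (u v : M) (a b : R) (z : M) :
  a + b <= mdist u v ->
  [\/ [/\ dipole u v a b z = a - mdist z u, mdist z u <= a
        & room u v a b z = 0],
      [/\ dipole u v a b z = mdist z v - b, mdist z v <= b
        & room u v a b z = 0]
    | [/\ dipole u v a b z = 0, room u v a b z <= mdist z u - a
        & room u v a b z <= mdist z v - b]].
Proof.
move=> ab; have := metric_triangle u z v; rewrite (metric_sym u z) => tri.
rewrite /dipole /room.
have pos (t : R) : 0 <= t -> Num.max t 0 = t /\ Num.max (- t) 0 = 0.
  by move=> t0; split; [exact: max_l|apply: max_r; rewrite oppr_le0].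
have [zu|zu] := leP a (mdist z u); last first.
  have [|] := pos (a - mdist z u); first by lra.
  have [|] := pos (mdist z v - b); first by lra.
  rewrite !opprB => -> -> -> ->; constructor 1.
  by rewrite subr0 min_l; [split=> //; lra|lra].
have [zv|zv] := leP b (mdist z v); last first.
  have [|] := pos (b - mdist z v); first by lra.
  have [|] := pos (mdist z u - a); first by lra.
  rewrite !opprB => -> -> -> ->; constructor 2.
  by rewrite sub0r opprB min_r; [split=> //; lra|lra].
have [|] := pos (mdist z u - a); first by lra.
have [|] := pos (mdist z v - b); first by lra.
rewrite !opprB => -> -> -> ->; constructor 3.
by rewrite subrr !ge_min !lexx orbT.
Qed.

Lemma dipole_nonexpansive (R : realType) (M : metricType R) (u v : M) (a b : R) :
  a + b <= mdist u v -> nonexpansive (dipole u v a b).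
Proof.
move=> ab z w.
have := metric_triangle z w u; have := metric_triangle z w v.
have := metric_triangle w z u; have := metric_triangle w z v.
have := metric_triangle u z v; have := metric_triangle u w v.
rewrite (metric_sym w z) (metric_sym u z) (metric_sym u w).
have := mdist_ge0 z w; have := room_ge0 u v a b z; have := room_ge0 u v a b w.
by case: (dipole_room z ab) => -[-> ? *];
  case: (dipole_room w ab) => -[-> ? *]; lra.
Qed.

(** Inside the balls the truncated function is the constant [c]; between a point
[z] inside and a point [w] outside, the slope of the cone is paid for by the
ball, and the departure from [c] by what remains of the distance after
leaving the ball.  Reversing the sign of [dipole] amounts to exchanging the
roles of [u] and [v]. *)
Lemma clamp_dipole_nonexpansive (R : realType) (M : metricType R) (u v : M)
    (a b c : R) (k : M -> R) : a + b <= mdist u v -> nonexpansive k ->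
  nonexpansive (fun z => clamp c (room u v a b z) (k z) + dipole u v a b z).
Proof.
move=> ab kl z w.
have := clamp_nonexpansive c (@room_nonexpansive _ _ u v a b) kl z w.
have := clamp_dist c (k z) (room_ge0 u v a b z).
have := clamp_dist c (k w) (room_ge0 u v a b w).
move: (clamp c _ _) (clamp c _ _) => fz fw.
rewrite !ler_norml => /andP[w1 w2] /andP[z1 z2] fzw.
have := dipole_nonexpansive ab z w.
have := metric_triangle z w u; have := metric_triangle z w v.
have := metric_triangle w z u; have := metric_triangle w z v.
rewrite (metric_sym w z).
have := mdist_ge0 z w; have := room_ge0 u v a b z; have := room_ge0 u v a b w.
by case: (dipole_room z ab) => -[-> ? ?];
  case: (dipole_room w ab) => -[-> ? ?]; lra.
Qed.

(** * Radii and centers from the trapezoid inequalities *)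

(** The last two conclusions are upper bounds on [a] and on [b] separately; the
hypothesis says that these bounds add up to at least [q * mdist u v].  So [a]
is taken as large as its bound and the target allow, and [b] is the rest. *)
Lemma trapezoid_radii (R : realType) (M : metricType R) (s : seq M) (u v p : M)
    (q : R) : p \in s -> 0 <= q <= 1 ->
  (forall x y z w, x \in s -> y \in s -> z \in s -> w \in s ->
    q * (2 * mdist u v + mdist x y + mdist z w)
      <= mdist x u + mdist y u + mdist z v + mdist w v) ->
  exists a b : R, [/\ 0 <= a, 0 <= b, a + b = q * mdist u v,
    forall x y, x \in s -> y \in s ->
      q * mdist x y + 2 * a <= mdist x u + mdist y u
    & forall x y, x \in s -> y \in s ->
      q * mdist x y + 2 * b <= mdist x v + mdist y v].
Proof.
move=> ps /andP[q0 q1] H.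
pose slack x y := (mdist x u + mdist y u - q * mdist x y) / 2.
have slack_ge0 (x y t : M) : 0 <= mdist x t + mdist y t - q * mdist x y.
  have := metric_triangle x t y; rewrite (metric_sym t y).
  have := ler_piMl (mdist_ge0 x y) q1; lra.
pose E := [set r : R | exists x y, [/\ x \in s, y \in s & r = slack x y]]%classic.
have E0 : (E !=set0)%classic by exists (slack p p), p, p.
have lbE : has_lbound E.
  by exists 0 => _ [x [y [_ _ ->]]]; have := slack_ge0 x y u; rewrite /slack; lra.
have D0 : 0 <= q * mdist u v by rewrite mulr_ge0 ?mdist_ge0.
have infle x y : x \in s -> y \in s -> inf E <= slack x y.
  by move=> xs ys; apply: ge_inf => //; exists x, y.
have inf0 : 0 <= inf E.
  apply: lb_le_inf => // _ [x [y [_ _ ->]]].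
  by have := slack_ge0 x y u; rewrite /slack; lra.
have infge z w : z \in s -> w \in s ->
    q * mdist u v - (mdist z v + mdist w v - q * mdist z w) / 2 <= inf E.
  move=> zs ws; apply: lb_le_inf => // _ [x [y [xs ys ->]]].
  by have := H x y z w xs ys zs ws; rewrite /slack; lra.
have [le|lt] := leP (inf E) (q * mdist u v).
  exists (inf E), (q * mdist u v - inf E); split=> //; try lra.
    by move=> x y xs ys; have := infle x y xs ys; rewrite /slack; lra.
  by move=> x y xs ys; have := infge x y xs ys; lra.
exists (q * mdist u v), 0; split=> //; try lra.
  by move=> x y xs ys; have := infle x y xs ys; rewrite /slack; lra.
by move=> x y xs ys; have := slack_ge0 x y v; lra.
Qed.

(** The intervals of center [k x] and radius [room u v a b x] meet pairwise.  The
room at [x] is a minimum over the two balls; whichever balls realise it at [x]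
and at [y], one of the three hypotheses bounds [k x - k y] by the sum of the
two radii. *)
Lemma clamp_center (R : realType) (M : metricType R) (s : seq M) (u v p : M)
    (a b : R) (k : M -> R) : p \in s ->
  (forall x y, x \in s -> y \in s ->
    k x - k y + 2 * a <= mdist x u + mdist y u) ->
  (forall x y, x \in s -> y \in s ->
    k x - k y + 2 * b <= mdist x v + mdist y v) ->
  (forall x y, x \in s -> y \in s ->
    `|k x - k y| + (a + b) <= mdist x u + mdist y v) ->
  exists c : R, forall x, x \in s -> `|k x - c| <= room u v a b x.
Proof.
move=> ps ku kv kuv.
pose r := room u v a b.
pose E := [set t : R | exists2 x, x \in s & t = k x - r x]%classic.
have E0 : (E !=set0)%classic by exists (k p - r p), p.
have key x y : x \in s -> y \in s -> k x - r x <= k y + r y.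
  move=> xs ys; have := ku x y xs ys; have := kv x y xs ys.
  have := kuv x y xs ys; have := kuv y x ys xs.
  have := ler_norm (k x - k y); have := ler_norm (k y - k x).
  rewrite (distrC (k y)) /r /room.
  have off (t : R) : t <= Num.max t 0 by rewrite le_max lexx.
  have := off (mdist x u - a); have := off (mdist x v - b).
  have := off (mdist y u - a); have := off (mdist y v - b).
  move: (Num.max _ _) (Num.max _ _) (Num.max _ _) (Num.max _ _) => yv yu xv xu.
  by case: (leP xu xv) => ?; case: (leP yu yv) => ?; lra.
(* The largest left endpoint lies in all the intervals. *)
exists (sup E) => x xs; rewrite ler_norml.
have lo : k x - r x <= sup E.
  apply: ub_le_sup; last by exists x.
  by exists (k x + r x) => _ [y ys ->]; exact: key.
have hi : sup E <= k x + r x by apply: ge_sup => // _ [y ys ->]; exact: key.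
by rewrite -/(r x); apply/andP; split; lra.
Qed.

(** * Slices depend on finitely many values *)

Lemma delta_span_local (R : realType) (M : metricType R) (p0 : M)
    (nu : dual (lip0 p0)) : delta_span p0 nu ->
  exists s : seq M, forall F G : lip0 p0, {in s, F =1 G} -> nu F = nu G.
Proof.
move=> [n [c [m ->]]]; exists [seq m i | i <- enum 'I_n] => F G FG.
have ev (H : lip0 p0) :
    (\sum_(i < n) c i *: delta p0 (m i)) H = \sum_(i < n) c i * H (m i).
  exact: (big_morph (fun mu : dual (lip0 p0) => mu H)).
rewrite !ev; apply: eq_bigr => i _; rewrite FG//.
by apply: map_f; rewrite mem_enum.
Qed.

(** Take [h] in the slice and [s] the support of a combination of point
evaluations close to the element [mu] that defines the slice.  The value of
[mu] at a function of the ball is then known from its values on [s] up to a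
small error, and the scaling by [1 - e] moves it by at most [e]. *)
Lemma wstar_slice_local (R : realType) (M : metricType R) (p0 : M)
    (S : set (lip0 p0)) : is_wstar_slice (lip0_dual p0) S ->
  exists (h : lip0 p0) (s : seq M) (e0 : R), [/\ `|h| <= 1, 0 < e0 &
    forall (e : R) (F : lip0 p0), 0 <= e <= e0 -> `|F| <= 1 ->
      {in s, forall x, F x = (1 - e) * h x} -> S F].
Proof.
move=> [mu [al [mu1 al0 ->]]].
have [h h1 muh] : exists2 h : lip0 p0, `|h| <= 1 & 1 - al < mu h.
  have : 1 - al < dual_norm (free_val mu).
    by rewrite -[dual_norm _]/(`|mu|) mu1; lra.
  move=> /sup_gt[|_ [h /= h1 <-]].
    by exists `|mu (0 : lip0 p0)|, 0 => //=; rewrite normr0.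
  case: (ger0P (mu h)) => _ H; first by exists h.
  by exists (- h); rewrite ?normrN// linearN.
have b0 : 0 < mu h - (1 - al) by lra.
(* [mu h] exceeds [1 - al] by a margin; a quarter of it is spent on the
approximation, as two functions of the ball are at distance at most 2, and
another quarter on the scaling. *)
have b80 : 0 < (mu h - (1 - al)) / 8 by lra.
have /free_predP/(_ _ b80)[nu /delta_span_local[s nus] munu] := valP mu.
exists h, s, (Num.min ((mu h - (1 - al)) / 4) 1); split=> //.
  by rewrite lt_min ltr01 andbT; lra.
move=> e F /andP[e0]; rewrite le_min => /andP[e_b e1] F1 Fh.
split=> //; rewrite -[X in _ < X]/(mu F).
have nuE : nu F = nu ((1 - e) *: h) by apply: nus => x /Fh.
have : `|(free_val mu - nu) (F - (1 - e) *: h)| <= (mu h - (1 - al)) / 8 * 2.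
  apply: le_trans (dual_normP _ _) _; apply: ler_pM.
  - exact: dual_norm_ge0.
  - exact: normr_ge0.
  - exact: ltW munu.
  - apply: le_trans (ler_normB _ _) _; rewrite -[2]/(1 + 1) lerD//.
    by rewrite normrZ mulr_ile1// ger0_norm; lra.
have -> : (free_val mu - nu) (F - (1 - e) *: h) = mu F - (1 - e) * mu h.
  rewrite -[LHS]/(mu (F - (1 - e) *: h) - nu (F - (1 - e) *: h)).
  have -> : nu (F - (1 - e) *: h) = 0 by rewrite linearB /= nuE subrr.
  by rewrite subr0 linearB linearZ.
have : `|mu h| <= 1.
  apply: le_trans (dual_normP _ _) _.
  by rewrite -[dual_norm _]/(`|mu|) mu1 mul1r.
rewrite !ler_norml => /andP[_ muh1] /andP[+ _].
have : e * mu h <= e by rewrite ler_piMr.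
lra.
Qed.

(** * From long trapezoids to symmetric slices *)

Lemma strong_LTP_SSD2P (R : realType) (M : metricType R) (p0 : M) :
  strong_LTP M -> wstar_SSD2P (lip0_dual p0).
Proof.
move=> LTP n S eps HS eps0.
have /boolp.choice[d Hd] : forall i, exists d : lip0 p0 * seq M * R,
    [/\ `|d.1.1| <= 1, 0 < d.2 &
      forall (e : R) (F : lip0 p0), 0 <= e <= d.2 -> `|F| <= 1 ->
        {in d.1.2, forall x, F x = (1 - e) * d.1.1 x} -> S i F].
  move=> i; have [h [s [e0 H]]] := wstar_slice_local (HS i).
  by exists (h, s, e0).
pose s := p0 :: flatten [seq (d i).1.2 | i <- enum 'I_n].
have sP i x : x \in (d i).1.2 -> x \in s.
  move=> xd; rewrite inE; apply/orP; right; apply/flatten_mapP.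
  by exists i => //; rewrite mem_enum.
have p0s : p0 \in s by rewrite mem_head.
pose e := \big[Num.min/Num.min (eps / 2) 1]_i (d i).2.
have e0 : 0 < e.
  apply: lt_bigmin => [|i _]; last by have [] := Hd i.
  by rewrite lt_min ltr01 andbT divr_gt0.
have [e1 eeps] : e <= 1 /\ e <= eps / 2.
  have : e <= Num.min (eps / 2) 1 by exact: bigmin_le_id.
  by rewrite le_min => /andP[].
have ed i : 0 <= e <= (d i).2 by rewrite ltW//= /e bigmin_le.
have q01 : 0 <= 1 - e <= 1 by apply/andP; split; lra.
have [u [v [uv tr1 tr2]]] := LTP _ e (finite_seq s) e0.
have [a [b [a0 b0 abE ra rb]]] := trapezoid_radii p0s q01 tr2.
have duv : 0 < mdist u v by rewrite mdist_gt0.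
have ab : a + b <= mdist u v by rewrite abE ler_piMl//; lra.
have ba : b + a <= mdist v u by rewrite addrC metric_sym.
have au x : x \in s -> a <= mdist x u.
  by move=> xs; have := ra x x xs xs; rewrite mdistxx; lra.
have bv x : x \in s -> b <= mdist x v.
  by move=> xs; have := rb x x xs xs; rewrite mdistxx; lra.
have dipole0 x : x \in s -> dipole u v a b x = 0.
  by move=> xs; rewrite /dipole !max_r ?subrr// subr_le0 ?au ?bv.
have [g gE g1] := nonexpansive_lip0 (dipole0 _ p0s) (dipole_nonexpansive ab).
pose k i x := (1 - e) * (d i).1.1 x.
have kl i x y : k i x - k i y <= (1 - e) * mdist x y.
  have [/lip0_le1P h1 _ _] := Hd i.
  by rewrite -mulrBr ler_wpM2l ?h1//; lra.
have /boolp.choice[c cP] : forall i, exists c, forall x, x \in s ->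
    `|k i x - c| <= room u v a b x.
  move=> i; apply: (clamp_center p0s) => x y xs ys.
  - by have := ra x y xs ys; have := kl i x y; lra.
  - by have := rb x y xs ys; have := kl i x y; lra.
  have := tr1 x y xs ys; rewrite mulrDr abE.
  suff : `|k i x - k i y| <= (1 - e) * mdist x y by lra.
  rewrite ler_norml kl andbT.
  by have := kl i y x; rewrite (metric_sym y x); lra.
(* On [s] the truncation changes nothing, by the choice of [c i]. *)
pose f i z := clamp (c i) (room u v a b z) (k i z).
have kne i : nonexpansive (k i).
  move=> z w; apply: le_trans (kl i z w) _.
  by rewrite ler_piMl ?mdist_ge0//; lra.
have fE i : {in s, f i =1 k i} by move=> x xs; apply/clamp_id/cP.
have f0 i : f i p0 = 0 by rewrite fE// /k lip0_base mulr0.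
have /boolp.choice[F FP] : forall i, exists F : lip0 p0, F =1 f i /\ `|F| <= 1.
  move=> i; have [F FE F1] := nonexpansive_lip0 (f0 i)
    (clamp_nonexpansive (c i) (@room_nonexpansive _ _ u v a b) (kne i)).
  by exists F.
have Fs i x : x \in s -> F i x = k i x by move=> xs; rewrite (FP i).1 fE.
have gs x : x \in s -> g x = 0 by move=> xs; rewrite gE dipole0.
exists F, g; split=> //.
- move=> i; have [_ _ Hi] := Hd i; apply: (Hi e) => //; first exact: (FP i).2.
  by move=> x /sP xs; rewrite Fs.
- move=> i; have [_ _ Hi] := Hd i; split; apply: (Hi e) => //.
  + apply/lip0_le1P => z w; rewrite -![(F i + g) _]/(F i _ + g _) !(FP i).1 !gE.
    exact: (clamp_dipole_nonexpansive (c i) ab (kne i)).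
  + move=> x /sP xs; rewrite -[LHS]/(F i x + g x) gs// addr0; exact: Fs.
  + apply/lip0_le1P => z w; rewrite -![(F i - g) _]/(F i _ - g _) !(FP i).1 !gE.
    have := clamp_dipole_nonexpansive (c i) ba (kne i) z w.
    by rewrite !(dipoleC u v) !(roomC u v).
  + move=> x /sP xs; rewrite -[LHS]/(F i x - g x) gs// subr0; exact: Fs.
have gu : g u = a.
  rewrite gE /dipole mdistxx subr0 max_l// max_r ?subr0//.
  by rewrite subr_le0; lra.
have gv : g v = - b.
  rewrite gE /dipole mdistxx subr0 max_r; last first.
    by rewrite metric_sym subr_le0; lra.
  by rewrite max_l// sub0r.
have := lip0_normP g u v; rewrite gu gv opprK ger0_norm ?addr_ge0// abE.
rewrite ler_pM2r// -[lip0_norm g]/(`|g|); lra.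
Qed.

(** * The equivalence *)

Theorem theorem2p1 (R : realType) (M : metricType R) (p0 : M) :
  wstar_SSD2P (lip0_dual p0) <-> strong_LTP M.
Proof.
split; [exact: SSD2P_strong_LTP|exact: strong_LTP_SSD2P].
Qed.
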